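(* Let $(a,b)=(z^3,\,z^2+z+1)\in(\mathbb{F}_2[z]\setminus\mathbb{F}_2)^2$. Let $\mathbf{p}$ be the $(a,b)$-period-doubling sequence. The power series $\mathrm{CF}(\mathbf{p}(z))\in\mathbb{F}_2((1/z))$ is algebraic over $\mathbb{F}_2(z)$; its minimal polynomial (in the unknown $y$) is $$y^4+(z^5+z^4+z^3)\,y^2+(z^8+z^6+z^5+z^3)\,y+z^5+z^3+z^2.$$
   Context: For two distinct elements $a,b$ of an alphabet, the $(a,b)$-period-doubling sequence is the fixed point $\sigma^\infty(a)$ (starting with $a$) of the substitution $\sigma: a\mapsto ab,\ b\mapsto aa$. For a field $K$ and a sequence $\mathbf{a}(z)=(a_j(z))_{j\ge0}$ of polynomials in $K[z]\setminus K$, the continued fraction $$\mathrm{CF}(\mathbf{a}(z))=\cfrac{1}{a_0(z)+\cfrac{1}{a_1(z)+\cfrac{1}{a_2(z)+\cdots}}}$$ is the limit in $K((1/z))$ (which exists) of the finite continued fractions $$\mathrm{CF}_n(\mathbf{a}(z))=\cfrac{1}{a_0(z)+\cfrac{1}{a_1(z)+\cfrac{1}{\ddots+\cfrac{1}{a_n(z)}}}}\,.$$ Rational fractions are expanded in powers of $1/z$. *)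

(* Defs.v *)
From HB Require Import structures.
From mathcomp Require Import all_boot all_order all_algebra.
From mathcomp Require Import generic_quotient boolp classical_sets functions.
From mathcomp Require Import cardinality fsbigop.
From mathcomp Require Import zify ring.

Set Implicit Arguments.
Unset Strict Implicit.
Unset Printing Implicit Defensive.

Import Order.TTheory GRing.Theory Num.Theory.
Local Open Scope ring_scope.

Notation "x %:F" := (FracField.tofrac x) : ring_scope.

(* The series [f] stands for [\sum_n f n * z^(-n)], where [n] ranges over
   [int]: the index is the exponent of 1/z, hence the opposite of the exponent
   of z. *)
Record laurent (K : fieldType) := Laurent {
  lcoef :> int -> K;
  lcoefP : exists N : int, forall n, n < N -> lcoef n = 0 }.

HB.instance Definition _ (K : fieldType) := gen_eqMixin (laurent K).
HB.instance Definition _ (K : fieldType) := gen_choiceMixin (laurent K).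

Section LaurentRing.
Variable K : fieldType.
Implicit Types f g h : laurent K.

Definition vge (N : int) f := forall n, n < N -> f n = 0.

Lemma vge_ex f : exists N, vge N f. Proof. by case: f. Qed.

Lemma vge_le (M N : int) f : M <= N -> vge N f -> vge M f.
Proof. by move=> MN fN n nM; apply: fN; apply: lt_le_trans MN. Qed.

Lemma laurentP f g : (forall n, f n = g n) -> f = g.
Proof.
case: f => f fP; case: g => g gP /= fg.
have eq_fg : f = g by apply/funext.
by case: _ / eq_fg gP {fg} => gP; congr Laurent; apply: Prop_irrelevance.
Qed.

Fact laurent0_subproof : exists N : int, forall n, n < N -> (0 : K) = 0.
Proof. by exists 0. Qed.
Definition laurent0 : laurent K := Laurent laurent0_subproof.

Fact laurent1_subproof :
  exists N : int, forall n, n < N -> (n == 0)%:R = 0 :> K.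
Proof. by exists 0 => n n0; rewrite lt_eqF. Qed.
Definition laurent1 : laurent K := Laurent laurent1_subproof.

Fact laurent_opp_subproof f : exists N : int, forall n, n < N -> - f n = 0.
Proof. by have [N fN] := vge_ex f; exists N => n /fN ->; rewrite oppr0. Qed.
Definition laurent_opp f : laurent K := Laurent (laurent_opp_subproof f).

Fact laurent_add_subproof f g :
  exists N : int, forall n, n < N -> f n + g n = 0.
Proof.
have [[N fN] [M gM]] := (vge_ex f, vge_ex g).
by exists (Num.min N M) => n; rewrite lt_min => /andP[/fN-> /gM->]; rewrite addr0.
Qed.
Definition laurent_add f g : laurent K := Laurent (laurent_add_subproof f g).

(* The Cauchy product: only finitely many terms of this sum are nonzero. *)
Definition conv f g (n : int) : K := \sum_(i \in [set: int]) f i * g (n - i).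

Lemma convE (r : seq int) f g n : uniq r ->
  (forall i, i \notin r -> f i * g (n - i) = 0) ->
  conv f g n = \sum_(i <- r) f i * g (n - i).
Proof.
move=> r_uniq r0; rewrite /conv (fsbigE r) //; last by move=> i _; apply: r0.
by apply: eq_bigl => i; rewrite in_setT.
Qed.

Lemma conv_lt (a b : int) f g n : vge a f -> vge b g -> n < a + b ->
  conv f g n = 0.
Proof.
move=> fa gb nab; rewrite (@convE [::]) ?big_nil // => i _.
have [ia|ai] := ltP i a; first by rewrite fa ?mul0r.
by rewrite gb ?mulr0 //; lia.
Qed.

Lemma conv_nat (a b : int) f g (m : nat) : vge a f -> vge b g ->
  conv f g (a + b + m%:Z) =
  \sum_(k < m.+1) f (a + k%:Z) * g (b + (m - k)%N%:Z).
Proof.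
move=> fa gb; rewrite (@convE [seq a + k%:Z | k <- iota 0 m.+1]).
- rewrite big_map -[iota _ _]/(index_iota 0 m.+1) big_mkord.
  by apply: eq_bigr => k _; congr (_ * g _); have := ltn_ord k; lia.
- by rewrite map_inj_uniq ?iota_uniq // => i j; lia.
move=> i ir; have [ia|ai] := ltP i a; first by rewrite fa ?mul0r.
rewrite gb ?mulr0 //; apply: contraNT ir => ir; apply/mapP.
by exists (absz (i - a)%R); rewrite ?mem_iota; lia.
Qed.

Fact laurent_mul_subproof f g : exists N : int, forall n, n < N -> conv f g n = 0.
Proof.
have [[N fN] [M gM]] := (vge_ex f, vge_ex g).
by exists (N + M) => n; apply: conv_lt.
Qed.
Definition laurent_mul f g : laurent K := Laurent (laurent_mul_subproof f g).

Lemma vge_mul (a b : int) f g : vge a f -> vge b g -> vge (a + b) (laurent_mul f g).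
Proof. by move=> fa gb n; apply: conv_lt. Qed.

Lemma laurent_mul_eq (a b : int) f g h : vge a f -> vge b g -> vge (a + b) h ->
  (forall m : nat, \sum_(k < m.+1) f (a + k%:Z) * g (b + (m - k)%N%:Z) =
     h (a + b + m%:Z)) ->
  laurent_mul f g = h.
Proof.
move=> fa gb hab eqh; apply: laurentP => n /=.
have [nab|nab] := ltP n (a + b); first by rewrite (conv_lt fa gb) ?hab.
have -> : n = a + b + (absz (n - (a + b))%R)%:Z by lia.
by rewrite (conv_nat _ fa gb).
Qed.

Definition ltrunc (m : nat) (a : int) f := \poly_(i < m.+1) f (a + i%:Z).

Lemma coef_ltruncM (a b : int) f g (m k : nat) : vge a f -> vge b g ->
  (k <= m)%N -> (ltrunc m a f * ltrunc m b g)`_k = laurent_mul f g (a + b + k%:Z).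
Proof.
move=> fa gb km; rewrite /= (conv_nat _ fa gb) coefM.
by apply: eq_bigr => i _; rewrite !coef_poly !ifT //; have := ltn_ord i; lia.
Qed.

Lemma laurent_mulC : commutative laurent_mul.
Proof.
move=> f g; have [[a fa] [b gb]] := (vge_ex f, vge_ex g).
apply: (laurent_mul_eq fa gb); first by rewrite addrC; apply: vge_mul.
move=> m; rewrite [a + b]addrC /= (conv_nat _ gb fa) (reindex_inj rev_ord_inj) /=.
apply: eq_bigr => k _; have km := ltn_ord k; rewrite mulrC subSS.
by congr (g (_ + _%:Z) * f _); lia.
Qed.

Lemma laurent_mulA : associative laurent_mul.
Proof.
move=> f g h.
have [[a fa] [[b gb] [c hc]]] := (vge_ex f, (vge_ex g, vge_ex h)).
have ab := vge_mul fa gb; have bc := vge_mul gb hc.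
apply: (laurent_mul_eq fa bc); first by rewrite addrA; apply: vge_mul.
move=> m; rewrite [a + _]addrA [RHS](conv_nat _ ab hc).
transitivity ((ltrunc m a f * (ltrunc m b g * ltrunc m c h))`_m).
  rewrite coefM; apply: eq_bigr => k _.
  by rewrite (coef_ltruncM gb hc) ?leq_subr // coef_poly ltn_ord.
rewrite mulrA coefM; apply: eq_bigr => k _.
by rewrite (coef_ltruncM fa gb) ?coef_poly ?ifT //; have := ltn_ord k; lia.
Qed.

Lemma laurent_addA : associative laurent_add.
Proof. by move=> f g h; apply: laurentP => n /=; rewrite addrA. Qed.
Lemma laurent_addC : commutative laurent_add.
Proof. by move=> f g; apply: laurentP => n /=; rewrite addrC. Qed.
Lemma laurent_add0 : left_id laurent0 laurent_add.
Proof. by move=> f; apply: laurentP => n /=; rewrite add0r. Qed.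
Lemma laurent_addN : left_inverse laurent0 laurent_opp laurent_add.
Proof. by move=> f; apply: laurentP => n /=; rewrite addNr. Qed.

HB.instance Definition _ := GRing.isZmodule.Build (laurent K)
  laurent_addA laurent_addC laurent_add0 laurent_addN.

Lemma laurent_mul1 : left_id laurent1 laurent_mul.
Proof.
move=> f; apply: laurentP => n /=; rewrite (@convE [:: 0]) //.
  by rewrite big_seq1 /= mul1r subr0.
by move=> i; rewrite inE /= => /negPf ->; rewrite mul0r.
Qed.

Lemma vgeD (a : int) f g : vge a f -> vge a g -> vge a (f + g).
Proof. by move=> fa ga n na; rewrite /= fa ?ga ?addr0. Qed.

Lemma vgeN (a : int) f : vge a f -> vge a (- f).
Proof. by move=> fa n na; rewrite /= fa ?oppr0. Qed.

Lemma laurent_mulDl : left_distributive laurent_mul +%R.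
Proof.
move=> f g h; have [[a fa] [[b gb] [c hc]]] := (vge_ex f, (vge_ex g, vge_ex h)).
pose d := Num.min a b.
have {}fa : vge d f by apply: vge_le fa; rewrite ge_min lexx.
have {}gb : vge d g by apply: vge_le gb; rewrite ge_min lexx orbT.
apply: (@laurent_mul_eq d c) => //; first exact: vgeD.
  by apply: vgeD; apply: vge_mul.
move=> m; rewrite /= (conv_nat _ fa hc) (conv_nat _ gb hc) -big_split /=.
by apply: eq_bigr => k _; rewrite mulrDl.
Qed.

Lemma laurent1_neq0 : laurent1 != 0.
Proof.
by apply/eqP => /(congr1 (fun f : laurent K => f 0))/=/eqP; rewrite oner_eq0.
Qed.

HB.instance Definition _ := GRing.Zmodule_isComNzRing.Build (laurent K)
  laurent_mulA laurent_mulC laurent_mul1 laurent_mulDl laurent1_neq0.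

Lemma lcoef0 n : (0 : laurent K) n = 0. Proof. by []. Qed.
Lemma lcoef1 n : (1 : laurent K) n = (n == 0)%:R. Proof. by []. Qed.
Lemma lcoefD f g n : (f + g) n = f n + g n. Proof. by []. Qed.
Lemma lcoefN f n : (- f) n = - f n. Proof. by []. Qed.
Lemma lcoefM f g n :
  (f * g) n = \sum_(i \in [set: int]) f i * g (n - i).
Proof. by []. Qed.

(* Coefficients of the inverse of the power series with coefficients [F]. *)
Fixpoint inv_prefix (F : nat -> K) (n : nat) : seq K :=
  if n is m.+1 then let s := inv_prefix F m in
    rcons s (((m == 0)%N%:R - \sum_(i < m) s`_i * F (m - i)%N) / F 0%N)
  else [::].

Lemma size_inv_prefix F n : size (inv_prefix F n) = n.
Proof. by elim: n => //= n IHn; rewrite size_rcons IHn. Qed.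

Lemma nth_inv_prefix F m n : (m < n)%N ->
  (inv_prefix F n)`_m = (inv_prefix F m.+1)`_m.
Proof.
elim: n => // n IHn; rewrite ltnS leq_eqVlt => /predU1P[->//|mn].
by rewrite {1}/inv_prefix -/inv_prefix nth_rcons size_inv_prefix mn IHn.
Qed.

Lemma inv_prefixP (F : nat -> K) : F 0%N != 0 -> forall m : nat,
  \sum_(k < m.+1) (inv_prefix F k.+1)`_k * F (m - k)%N = (m == 0)%N%:R.
Proof.
move=> F0 m; rewrite big_ord_recr /= nth_rcons size_inv_prefix ltnn eqxx subnn.
rewrite divfK // (eq_bigr (fun i : 'I_m => (inv_prefix F m)`_i * F (m - i)%N)).
  by rewrite addrC subrK.
by move=> i _; rewrite -(@nth_inv_prefix F i m).
Qed.

Lemma laurent_inv_ex (a : int) f : vge a f -> f a != 0 ->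
  exists2 g, vge (- a) g & g * f = 1.
Proof.
move=> fa f0; pose F (k : nat) := f (a + k%:Z).
pose G (n : int) := if n + a is Posz k then (inv_prefix F k.+1)`_k else 0.
have G0 n : n < - a -> G n = 0.
  by move=> na; rewrite /G; case E: (n + a) => [k|//]; lia.
have GP : exists N : int, forall n, n < N -> G n = 0 by exists (- a).
exists (Laurent GP) => //.
apply: (@laurent_mul_eq (- a) a); rewrite ?addNr //.
  by move=> n n0; rewrite lcoef1 lt_eqF.
move=> m; rewrite add0r lcoef1 -(@inv_prefixP F) ?/F ?addr0 //.
by apply: eq_bigr => k _; rewrite /= /G addrAC addNr add0r.
Qed.

Lemma laurent_lead f : f != 0 -> exists2 a : int, vge a f & f a != 0.
Proof.
move=> f0; have [a fa] := vge_ex f.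
have exk : exists k : nat, f (a + k%:Z) != 0.
  apply: contrapT => nk; case/eqP: f0; apply: laurentP => n.
  have [na|an] := ltP n a; first exact: fa.
  apply/eqP; apply: contrapT => fn; case: nk; exists (absz (n - a)%R).
  by have -> : a + (absz (n - a)%R)%:Z = n by [lia]; apply/negP.
case: (ex_minnP exk) => k fk kmin; exists (a + k%:Z) => // n nk.
have [na|an] := ltP n a; first exact: fa.
apply/eqP; apply: contrapT => /negP fn.
have := kmin (absz (n - a)%R); have -> : a + (absz (n - a)%R)%:Z = n by lia.
by move=> /(_ fn); lia.
Qed.

Lemma laurent_inv_ex' f : exists g, (f != 0 -> g * f = 1) /\ (f = 0 -> g = 0).
Proof.
have [->|f0] := eqVneq f 0; first by exists 0.
have [a fa fa0] := laurent_lead f0; have [g _ gf] := laurent_inv_ex fa fa0.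
by exists g; split=> // f00; rewrite f00 eqxx in f0.
Qed.

Definition laurent_inv f : laurent K := sval (cid (laurent_inv_ex' f)).

Lemma laurent_mulV f : f != 0 -> laurent_inv f * f = 1.
Proof. by rewrite /laurent_inv; case: cid => g []. Qed.

Lemma laurent_inv0 : laurent_inv 0 = 0.
Proof. by rewrite /laurent_inv; case: cid => g /= [_ ->]. Qed.

HB.instance Definition _ := GRing.ComNzRing_isField.Build (laurent K)
  laurent_mulV laurent_inv0.

Lemma vgeV (a : int) f : vge a f -> f a != 0 -> vge (- a) f^-1.
Proof.
move=> fa fa0; have [g ga gf] := laurent_inv_ex fa fa0.
suff -> : f^-1 = g by [].
have f0 : f != 0 by apply: contraNneq fa0 => ->.
by rewrite -[LHS]mul1r -gf mulfK.
Qed.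

End LaurentRing.

Section Expansion.
Variable K : fieldType.
Implicit Types p q : {poly K}.

(* By the indexing convention of [laurent], z^i has its coefficient at [-i]. *)
Definition poly_coef p (n : int) : K := if n <= 0 then p`_(absz n) else 0.

Fact poly_laurent_subproof p :
  exists N : int, forall n, n < N -> poly_coef p n = 0.
Proof.
exists (- (size p)%:Z) => n np; rewrite /poly_coef; case: ifP => // n0.
by have sp : (size p <= absz n)%N by [lia]; rewrite nth_default.
Qed.
Definition poly_laurent p : laurent K := Laurent (poly_laurent_subproof p).

Fact poly_laurent_is_zmod_morphism : zmod_morphism poly_laurent.
Proof.
move=> p q; apply: laurentP => n /=; rewrite /poly_coef.
by case: ifP => _; rewrite ?subr0 // coefB.
Qed.
HB.instance Definition _ := GRing.isZmodMorphism.Build {poly K} (laurent K)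
  poly_laurent poly_laurent_is_zmod_morphism.

Fact poly_laurent_is_monoid_morphism : monoid_morphism poly_laurent.
Proof.
split=> [|p q]; apply: laurentP => n.
  rewrite lcoef1 /= /poly_coef coef1 absz_eq0; case: ifP => // n0.
  by case: eqP => // n00; rewrite n00 in n0.
pose M := ((absz n).+1 + size p)%N.
rewrite /= (@convE _ [seq - k%:Z | k <- iota 0 M]).
- rewrite big_map -[iota 0 M]/(index_iota 0 M) big_mkord.
  rewrite {1}/poly_coef; case: ifP => n0; last first.
    rewrite big1 // => k _; rewrite [poly_laurent q _]/=/poly_coef ifF ?mulr0 //; lia.
  rewrite coefM (big_ord_widen _ (fun k => p`_k * q`_(absz n - k)%N)
    (leq_addr (size p) (absz n).+1)) big_mkcond /=.
  apply: eq_bigr => -[k kM] _ /=; rewrite /poly_coef abszN absz_nat.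
  have -> : - k%:Z <= 0 by lia.
  rewrite ltnS; case: leqP => kn.
    have -> : n - - k%:Z <= 0 by lia.
    by congr (_ * q`_ _); lia.
  by have -> : (n - - k%:Z <= 0) = false by [lia]; rewrite mulr0.
- by rewrite map_inj_uniq ?iota_uniq // => i j; lia.
move=> i iM; rewrite /= {1}/poly_coef; case: ifP => [i0|_]; rewrite ?mul0r //.
have [ip|pi] := ltnP (absz i) (size p); last by rewrite nth_default ?mul0r.
case/mapP: iM; exists (absz i); last by lia.
by rewrite mem_iota /M; move: ip; set s := size _; lia.
Qed.
HB.instance Definition _ := GRing.isMonoidMorphism.Build {poly K} (laurent K)
  poly_laurent poly_laurent_is_monoid_morphism.

Lemma poly_laurent_eq0 p : (poly_laurent p == 0) = (p == 0).
Proof.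
apply/eqP/eqP => [p0|->]; last exact: rmorph0.
apply/polyP => i; move/(congr1 (fun f : laurent K => f (- i%:Z))): p0.
rewrite /= /poly_coef coef0 abszN absz_nat.
by have -> : - i%:Z <= 0 by lia.
Qed.

(* Independent of the chosen representative of the fraction: [expandE]. *)
Definition expand (x : {fraction {poly K}}) : laurent K :=
  poly_laurent \n_(repr x) / poly_laurent \d_(repr x).

Lemma fracE (x : {fraction {poly K}}) : x = (\n_(repr x))%:F / (\d_(repr x))%:F.
Proof.
rewrite -[LHS]reprK; move: (repr x) => r {x}.
have rd : \d_r != 0 by apply: denom_ratioP.
apply: (canRL (mulfK _)); first by rewrite tofrac_eq0.
unlock FracField.tofrac; rewrite -[LHS]FracField.pi_mul; apply/eqmodP => /=.
rewrite FracField.equivfE /FracField.mulf /= !numden_Ratio ?mulf_neq0 ?oner_eq0 //.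
by rewrite !mulr1 mulrC.
Qed.

Lemma expandE p q : q != 0 ->
  expand (p%:F / q%:F) = poly_laurent p / poly_laurent q.
Proof.
move=> q0; rewrite /expand; set x := p%:F / q%:F.
have d0 : \d_(repr x) != 0 by apply: denom_ratioP.
have xE := fracE x.
apply/eqP; rewrite eqr_div ?poly_laurent_eq0 // -!rmorphM /=.
apply/eqP; congr poly_laurent; apply/eqP; rewrite -tofrac_eq !rmorphM /=.
by rewrite -eqr_div ?tofrac_eq0 // -xE.
Qed.

Lemma expand_tofrac p : expand p%:F = poly_laurent p.
Proof.
by have := expandE p (oner_neq0 _); rewrite !rmorph1 !divr1.
Qed.

Lemma fracP (x : {fraction {poly K}}) :
  exists p q, q != 0 /\ x = p%:F / q%:F.
Proof.
exists \n_(repr x), \d_(repr x); split; [exact: denom_ratioP | exact: fracE].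
Qed.

Fact expand_is_zmod_morphism : zmod_morphism expand.
Proof.
move=> x y; have [p [q [q0 ->]]] := fracP x; have [r [s [s0 ->]]] := fracP y.
rewrite !expandE // -[in LHS]mulNr -[in RHS]mulNr !addf_div ?tofrac_eq0 ?poly_laurent_eq0 //.
by rewrite -!rmorphN -!rmorphM -!rmorphD /= expandE ?mulf_neq0.
Qed.
HB.instance Definition _ := GRing.isZmodMorphism.Build
  {fraction {poly K}} (laurent K) expand expand_is_zmod_morphism.

Fact expand_is_monoid_morphism : monoid_morphism expand.
Proof.
split=> [|x y]; first by rewrite -tofrac1 expand_tofrac rmorph1.
have [p [q [q0 ->]]] := fracP x; have [r [s [s0 ->]]] := fracP y.
by rewrite !expandE // !mulf_div -!rmorphM /= expandE ?mulf_neq0.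
Qed.
HB.instance Definition _ := GRing.isMonoidMorphism.Build
  {fraction {poly K}} (laurent K) expand expand_is_monoid_morphism.

End Expansion.

Section ContinuedFraction.
Variable K : fieldType.
Implicit Types (a : nat -> {poly K}) (l : laurent K).

(* Convergence for the (1/z)-adic topology: for every [N], the difference is
   eventually in z^(-N) K[[1/z]]. *)
Definition laurent_cvg (u : nat -> laurent K) l : Prop :=
  forall N : int, exists n0 : nat, forall n : nat, (n0 <= n)%N ->
    forall i : int, i < N -> u n i = l i.

(* The junk value 0 is taken only when there is no limit; see [CF_cvg]. *)
Definition laurent_lim (u : nat -> laurent K) : laurent K :=
  xget 0 [set l | laurent_cvg u l]%classic.

Fixpoint CFn a (n : nat) : {fraction {poly K}} :=
  if n is m.+1 then ((a 0%N)%:F + CFn (fun j => a j.+1) m)^-1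
  else (a 0%N)%:F^-1.

Definition CF a : laurent K := laurent_lim (fun n => expand (CFn a n)).

Lemma laurent_cvg_unique (u : nat -> laurent K) l1 l2 :
  laurent_cvg u l1 -> laurent_cvg u l2 -> l1 = l2.
Proof.
move=> u1 u2; apply: laurentP => i.
have [[n1 un1] [n2 un2]] := (u1 (i + 1), u2 (i + 1)).
by rewrite -(un1 (n1 + n2)%N) ?leq_addr ?ltzD1 // (un2 (n1 + n2)%N) ?leq_addl ?ltzD1.
Qed.

Lemma vge_inv_add (p : {poly K}) (x : laurent K) : (1 < size p)%N -> vge 1 x ->
  poly_laurent p + x != 0 /\ vge 1 (poly_laurent p + x)^-1.
Proof.
move=> p1 x1; pose d := (size p).-1; have dp : size p = d.+1 by rewrite /d; lia.
have vd : vge (- d%:Z) (poly_laurent p + x).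
  move=> i id; rewrite lcoefD x1 ?addr0 /= /poly_coef; last by lia.
  by case: ifP => // i0; rewrite nth_default ?dp //; lia.
have nd : (poly_laurent p + x) (- d%:Z) != 0.
  rewrite lcoefD x1 ?addr0 /= /poly_coef; last by lia.
  have -> : - d%:Z <= 0 by lia.
  rewrite abszN absz_nat -[_`_d]/(lead_coef p) lead_coef_eq0.
  by rewrite -size_poly_gt0 dp.
split; first by apply: contraNneq nd => ->.
by apply: vge_le (vgeV vd nd); rewrite opprK; lia.
Qed.

Lemma expand_CFnS a n : expand (CFn a n.+1) =
  (poly_laurent (a 0%N) + expand (CFn (fun j => a j.+1) n))^-1.
Proof. by rewrite /= fmorphV rmorphD /= expand_tofrac. Qed.

Lemma vge_CFn a n : (forall j, 1 < size (a j))%N -> vge 1 (expand (CFn a n)).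
Proof.
elim: n a => [|n IHn] a a1.
  rewrite /= fmorphV /= expand_tofrac -[poly_laurent _]addr0.
  exact: (@vge_inv_add (a 0%N) 0 (a1 0%N) _).2.
rewrite expand_CFnS.
exact: (vge_inv_add (a1 0%N) (IHn _ (fun j => a1 j.+1))).2.
Qed.

Lemma vge_CFnB a n k : (forall j, 1 < size (a j))%N ->
  vge n.+1%:Z (expand (CFn a (n + k)) - expand (CFn a n)).
Proof.
elim: n a => [|n IHn] a a1.
  by apply: vgeD; last apply: vgeN; apply: vge_CFn.
have b1 j : (1 < size (a j.+1))%N by [].
rewrite addSn !expand_CFnS; set p := poly_laurent _.
set x := expand (CFn _ (n + k)); set y := expand (CFn _ n).
have [px vx] := vge_inv_add (a1 0%N) (vge_CFn (n + k) b1).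
have [py vy] := vge_inv_add (a1 0%N) (vge_CFn n b1).
have -> : (p + x)^-1 - (p + y)^-1 = - (x - y) * ((p + x)^-1 * (p + y)^-1).
  by field; rewrite px py.
have := vge_mul (vgeN (IHn _ b1)) (vge_mul vx vy).
by apply: vge_le; lia.
Qed.

Lemma CF_cvg a : (forall j, 1 < size (a j))%N ->
  laurent_cvg (fun n => expand (CFn a n)) (CF a).
Proof.
move=> a1; rewrite /CF /laurent_lim; apply: xgetPex => /=.
have lP : exists N : int, forall n, n < N -> expand (CFn a (absz n)) n = 0.
  by exists 1 => n n1; apply: (vge_CFn _ a1).
exists (Laurent lP) => N; exists (absz N) => n Nn i iN.
change (expand (CFn a n) i = expand (CFn a (absz i)) i); have [i1|i1] := ltP i 1; first by rewrite (vge_CFn n a1) // (vge_CFn _ a1).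
have in_ : (absz i <= n)%N by lia.
have := @vge_CFnB a (absz i) (n - absz i)%N a1; rewrite subnKC // => /(_ i).
by rewrite lcoefD lcoefN => lt_i; apply/eqP; rewrite -subr_eq0 lt_i //; lia.
Qed.

End ContinuedFraction.

Definition minimal_polynomial (F E : fieldType) (iota : F -> E) (u : E)
    (p : {poly F}) : Prop :=
  [/\ p \is monic, root (map_poly iota p) u &
      forall q : {poly F}, q != 0 -> root (map_poly iota q) u ->
        (size p <= size q)%N].

Section Substitution.
Variable T : eqType.
Implicit Types (s : T -> seq T) (w : seq T) (u : nat -> T) (a b : T).

Definition subst_word s w : seq T := flatten [seq s x | x <- w].

(* [subst_seq s u] is the concatenation [s (u 0) ++ s (u 1) ++ ...]; the
   first [n.+1] blocks suffice to read its [n]-th letter, the images [s x]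
   being nonempty. *)
Definition subst_seq s u (n : nat) : T :=
  nth (u 0%N) (subst_word s (mkseq u n.+1)) n.

(* The values on letters other than [a] and [b] are irrelevant. *)
Definition pd_subst a b (x : T) : seq T := if x == a then [:: a; b] else [:: a; a].

(* [s^oo(a)], when [s a] begins with [a]: its [n]-th letter is read off
   [s^(n+1)(a)], which is long enough when all the images [s x] have length at
   least 2. *)
Definition subst_fixpoint s a (n : nat) : T :=
  nth a (iter n.+1 (subst_word s) [:: a]) n.

Definition period_doubling a b : nat -> T := subst_fixpoint (pd_subst a b) a.

Lemma subst_word_cat s w1 w2 :
  subst_word s (w1 ++ w2) = subst_word s w1 ++ subst_word s w2.
Proof. by rewrite /subst_word map_cat flatten_cat. Qed.

Lemma size_pd_word a b w : size (subst_word (pd_subst a b) w) = (size w).*2.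
Proof.
elim: w => //= x w IHw; rewrite size_cat IHw /pd_subst.
by case: ifP => _; rewrite doubleS.
Qed.

Lemma size_pd_iter a b n :
  size (iter n (subst_word (pd_subst a b)) [:: a]) = (2 ^ n)%N.
Proof. by elim: n => //= n IHn; rewrite size_pd_word IHn expnS mul2n. Qed.

Lemma pd_iter_prefix a b m n : (m <= n)%N -> exists w,
  iter n (subst_word (pd_subst a b)) [:: a] =
  iter m (subst_word (pd_subst a b)) [:: a] ++ w.
Proof.
elim: n m => [|n IHn] [|m] //= mn; try by exists [::].
  have [w ->] := IHn 0%N isT; rewrite /= /subst_word /= /pd_subst eqxx /=.
  by eexists.
by have [w ->] := IHn m mn; rewrite subst_word_cat; eexists.
Qed.

Lemma period_doublingE a b m n : (n < 2 ^ m)%N ->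
  period_doubling a b n = nth a (iter m (subst_word (pd_subst a b)) [:: a]) n.
Proof.
move=> nm; have nn : (n < 2 ^ n.+1)%N.
  by rewrite (leq_trans (ltn_expl n (leqnn 2))) // leq_exp2l.
have [w1 E1] := pd_iter_prefix a b (leq_maxl m n.+1).
have [w2 E2] := pd_iter_prefix a b (leq_maxr m n.+1).
have E : nth a (iter n.+1 (subst_word (pd_subst a b)) [:: a] ++ w2) n =
         nth a (iter m (subst_word (pd_subst a b)) [:: a] ++ w1) n.
  by rewrite -E2 E1.
by move: E; rewrite !nth_cat !size_pd_iter nn nm.
Qed.

Lemma period_doubling0 a b : period_doubling a b 0 = a.
Proof. by rewrite (@period_doublingE a b 0). Qed.

Lemma period_doubling_fixed a b :
  subst_seq (pd_subst a b) (period_doubling a b) =1 period_doubling a b.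
Proof.
move=> n; pose W m := iter m (subst_word (pd_subst a b)) [:: a].
have nn : (n < 2 ^ n.+1)%N.
  by rewrite (leq_trans (ltn_expl n (leqnn 2))) // leq_exp2l.
have pE : mkseq (period_doubling a b) n.+1 = take n.+1 (W n.+1).
  apply: (@eq_from_nth _ a) => [|i].
    rewrite size_mkseq size_takel // size_pd_iter; exact: nn.
  rewrite size_mkseq => ilt; rewrite nth_mkseq // nth_take //.
  by apply: period_doublingE; apply: leq_ltn_trans nn.
rewrite /subst_seq period_doubling0 pE (@period_doublingE a b n.+2); last first.
  by rewrite (ltn_trans nn) // ltn_exp2l.
rewrite -[iter n.+2 _ _]/(subst_word (pd_subst a b) (W n.+1)).
rewrite -[in RHS](cat_take_drop n.+1 (W n.+1)) subst_word_cat nth_cat.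
rewrite size_pd_word size_takel ?size_pd_iter // ifT //.
by rewrite -addnn ltn_addr.
Qed.

End Substitution.

(* Main.v *)
Require Import Defs.
From HB Require Import structures.
From mathcomp Require Import all_boot all_order all_algebra.
From mathcomp Require Import zify ring.

(** Write [s] for the substitution and [x_k] for [a] when [k] is even, [b] when
[k] is odd. Then [s^k(a) = w_k x_k], where the words [w_k] satisfy
[w_(k+1) = w_k x_k w_k] ([pd_iter_core]), so they are palindromes. The matrix
of the continued fraction on a palindrome is symmetric, of determinant 1 in
characteristic 2: if [q_k] is its top left entry and [p_k] its off-diagonal
one, the recursion for the words becomes
[[
  q_(k+1) = x_k q_k^2,     p_(k+1) / q_(k+1) = p_k / q_k + 1 / (x_k q_k^2).
]]
Hence the convergents along the [w_k] are the partial sums [S_k] of the series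
[1/q_1 + 1/q_2 + ...], whose terms are explicit monomials in [1/a] and [1/b].
Split the sum as [y = y0 + y1], with [y0] over even and [y1] over odd indices:
squaring shifts the series, so that [b y0 = y1^2] and [a y1 = 1 + y0^2].
Eliminating [y0] and [y1] gives, for all nonconstant [a] and [b] in
characteristic 2,
[[
  y^4 + a b y^2 + a b (a + b) y + (1 + b^2 + a b) = 0.
]]
The formal proof works with the partial sums. The value of the left-hand side
at [S_(2m)] is exactly [e^2 + b (a + b) e], where [e = q_(2m)^(-2)]
([pd_quartic_sum]), and this tends to 0 while [S_(2m)] tends to the continued
fraction ([pd_quartic_CF]).

Since the quartic has a zero at the continued fraction, its minimality amounts
to its irreducibility over [F_2(z)]. It has no root there ([quartic_no_root]):
its coefficients below the leading one have [z]-adic valuations 3, 3, 2, so a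
root would have valuation 1/2. A factorization into two quadratics
[(Y^2 + s Y + t) (Y^2 + s Y + t')] would give [s^3 + alpha s = beta] with
[alpha], [beta] of degrees 5 and 8. This has no solution
([resolvent_no_root]): if [deg s >= 3] then [s^3] has the largest degree, and if
[deg s <= 2] then [beta] has. *)

Set Implicit Arguments.
Unset Strict Implicit.
Unset Printing Implicit Defensive.

Import Order.TTheory GRing.Theory Num.Theory.
Local Open Scope ring_scope.

(** * Palindromic prefixes of the period-doubling sequence *)

Section Word.
Variable T : eqType.
Implicit Types (a b : T) (k : nat).

Definition pd_letter a b k : T := if odd k then b else a.

Fixpoint pd_core a b k : seq T :=
  if k is j.+1 then pd_core a b j ++ pd_letter a b j :: pd_core a b j
  else [::].

Lemma size_pd_core a b k : (size (pd_core a b k)).+1 = (2 ^ k)%N.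
Proof. by elim: k => //= k IHk; rewrite size_cat /= addnS -addSn -addnS IHk expnS mul2n addnn. Qed.

Lemma subst_word_iter_cat s (w1 w2 : seq T) k :
  iter k (subst_word s) (w1 ++ w2) =
  iter k (subst_word s) w1 ++ iter k (subst_word s) w2.
Proof. by elim: k => //= k ->; rewrite subst_word_cat. Qed.

(** The images [s^k(a)] and [s^k(b)] differ in their last letter only, and the
letters alternate with [k]; hence [s^(k+1)(a) = s^k(a) s^k(b)] has the shape
[w x w x'] with a common [w]. *)
Lemma pd_iter_core a b k :
  iter k (subst_word (pd_subst a b)) [:: a] =
    rcons (pd_core a b k) (pd_letter a b k) /\
  iter k (subst_word (pd_subst a b)) [:: b] =
    rcons (pd_core a b k) (pd_letter a b k.+1).
Proof.
elim: k => [|k [IHa IHb]]; first by [].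
have sa : subst_word (pd_subst a b) [:: a] = [:: a] ++ [:: b].
  by rewrite /subst_word /= /pd_subst eqxx.
have sb : subst_word (pd_subst a b) [:: b] = [:: a] ++ [:: a].
  by rewrite /subst_word /= /pd_subst; case: eqP => //= ->.
rewrite !iterSr sa sb !subst_word_iter_cat IHa IHb /=.
by rewrite /pd_letter /= negbK !cat_rcons -!cats1 -!catA.
Qed.

Lemma pd_prefix a b k :
  mkseq (period_doubling a b) (2 ^ k).-1 = pd_core a b k.
Proof.
have sz := size_pd_core a b k.
apply: (@eq_from_nth _ a) => [|i]; rewrite size_mkseq -sz //= => ik.
rewrite nth_mkseq // (@period_doublingE _ a b k) -?sz; last exact: ltnW.
by rewrite (pd_iter_core a b k).1 nth_rcons ik.
Qed.

Lemma pd_letter_or a b n :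
  period_doubling a b n = a \/ period_doubling a b n = b.
Proof.
have: period_doubling a b n \in pd_core a b n.+2.
  rewrite -pd_prefix; apply: map_f; rewrite mem_iota /= add0n.
  by have := ltn_expl n.+2 (leqnn 2); lia.
elim: n.+2 => //= k IHk; rewrite mem_cat in_cons => /or3P[//|/eqP->|//].
by rewrite /pd_letter; case: odd; [right|left].
Qed.

End Word.

(** * The quartic and the continued fraction step in characteristic 2 *)

Section Char2.
Variables (E : fieldType) (char2E : 2%N \in [pchar E]).
Implicit Types a b e s t x : E.

Lemma sqrrD_pchar2 x y : (x + y) ^+ 2 = x ^+ 2 + y ^+ 2.
Proof. by rewrite sqrrD mulr2n addrr_pchar2 // addr0. Qed.

Definition pd_quartic a b x : E :=
  x ^+ 4 + a * b * x ^+ 2 + a * b * (a + b) * x + (1 + b ^+ 2 + a * b).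

(** In characteristic 2 the nonconstant part of the quartic is additive; this
governs both the passage from one partial sum to the next and the limit. *)
Lemma pd_quarticD a b x d : pd_quartic a b (x + d) =
  pd_quartic a b x + d * (d ^+ 3 + a * b * d + a * b * (a + b)).
Proof.
rewrite /pd_quartic -[4%N]/(2 * 2)%N !exprM !sqrrD_pchar2; ring.
Qed.

(** Two consecutive terms [e / a] and [(e / a)^2 / b] are added at once because
the letters alternate with period 2. With [e = q^(-2)], the new error
[e'] is [(b a^2 q^4)^(-2)]. *)
Lemma pd_quartic_step a b s e : a != 0 -> b != 0 ->
  pd_quartic a b s = e ^+ 2 + b * (a + b) * e ->
  let e' := ((e / a) ^+ 2 / b) ^+ 2 in
  pd_quartic a b (s + e / a + (e / a) ^+ 2 / b) =
    e' ^+ 2 + b * (a + b) * e'.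
Proof.
move=> a0 b0 Ps /=; rewrite !pd_quarticD Ps; apply/eqP; rewrite -subr_eq0; apply/eqP.
(* Once expanded, the two sides differ by [2 c] in any characteristic. *)
pose c := e ^+ 2 + b * (a + b) * e + b / a * e ^+ 2.
transitivity (2%:R * c); last by rewrite (pcharf0 char2E) mul0r.
by rewrite /c; field; rewrite a0 b0.
Qed.

(** A symmetric matrix [[q, p], [p, r]] of determinant 1 acts on [t] by
[(p + r t) / (q + p t)], which equals [s + e t / (1 + s t)] for [s = p / q] and
[e = q^(-2)] in characteristic 2. The two parameters [s], [e] thus describe the
action of a palindrome, and the identity below is the effect on them of
[w -> w x w]. *)
Lemma pd_moebius_step x s e t : x != 0 -> 1 + s * t != 0 ->
    x + e * t / (1 + s * t) != 0 -> x + (s + e * t / (1 + s * t)) != 0 ->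
  let u := (x + (s + e * t / (1 + s * t)))^-1 in
  let s' := s + e / x in let e' := (e / x) ^+ 2 in
  s + e * u / (1 + s * u) = s' + e' * t / (1 + s' * t).
Proof.
move=> x0 st0 xe0 xs0 u s' e'.
have D0 : x * (1 + s * t) + e * t != 0.
  have -> : x * (1 + s * t) + e * t =
    (x + e * t / (1 + s * t)) * (1 + s * t) by field.
  exact: mulf_neq0.
have E1 : 1 + s * u = (x + e * t / (1 + s * t)) * u.
  rewrite -{1}(mulfV xs0) -/u -mulrDl; congr (_ * u).
  by rewrite [s + _]addrC addrA -[LHS]addrA addrr_pchar2 // addr0.
have E2 : 1 + s' * t = (x * (1 + s * t) + e * t) / x by rewrite /s'; field.
have u0 : u != 0 by rewrite invr_eq0.
rewrite E1 E2 -mulf_div divff // mulr1 /s' /e'.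
rewrite -[_ * t / _ in RHS](oppr_pchar2 char2E).
by field; rewrite x0 D0 st0.
Qed.

End Char2.

(** * Convergents along the palindromic prefixes *)

Section Convergents.
Variables (K : fieldType).
Implicit Types (p : {poly K}) (w : seq {poly K}) (f t : laurent K).

(** The tail [t] is kept as an argument so that the continued fraction of a
concatenation of words is a composition. *)
Definition cf_word w t : laurent K :=
  foldr (fun p u => (poly_laurent p + u)^-1) t w.

Lemma cf_word_cat w1 p w2 t : cf_word (w1 ++ p :: w2) t =
  cf_word w1 (poly_laurent p + cf_word w2 t)^-1.
Proof. by rewrite /cf_word foldr_cat. Qed.

Lemma expand_CFn_word (u : nat -> {poly K}) n :
  expand (CFn u n) = cf_word (mkseq u n.+1) 0.
Proof.
elim: n u => [|n IHn] u.
  by rewrite /= fmorphV /= expand_tofrac addr0.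
rewrite expand_CFnS IHn.
by rewrite -[mkseq u n.+2]/(u 0%N :: map u (iota (1 + 0) n.+1)) iotaDl -map_comp.
Qed.

Lemma vge_cf_word w t : all (fun p => 1 < size p)%N w -> vge 1 t ->
  vge 1 (cf_word w t).
Proof.
by move=> + t1; elim: w => //= p w IHw /andP[p1 /IHw]; case/(vge_inv_add p1).
Qed.

Lemma add1_vge1_neq0 f : vge 1 f -> 1 + f != 0.
Proof.
move=> f1; apply/eqP => /(congr1 (fun g : laurent K => g 0)).
by rewrite lcoefD f1 // lcoef1 addr0 => /eqP; rewrite oner_eq0.
Qed.

Lemma vge_poly_inv p : (1 < size p)%N -> vge 1 (poly_laurent p)^-1.
Proof. by move=> p1; rewrite -[poly_laurent p]addr0; case: (@vge_inv_add _ p 0). Qed.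

Section TwoLetters.
Variables (a b : {poly K}) (char2K : 2%N \in [pchar K]).
Hypotheses (a_gt1 : (1 < size a)%N) (b_gt1 : (1 < size b)%N).
Local Notation A := (poly_laurent a).
Local Notation B := (poly_laurent b).

(** This is [q_k^(-2)], for [q_(k+1) = x_k q_k^2] and [q_0 = 1]. *)
Fixpoint pd_err k : laurent K :=
  if k is j.+1 then (pd_err j / poly_laurent (pd_letter a b j)) ^+ 2 else 1.

(** The [j]-th term is [1 / q_(j+1)]. *)
Definition pd_sum k : laurent K :=
  \sum_(j < k) pd_err j / poly_laurent (pd_letter a b j).

Lemma pchar_laurent2 : 2%N \in [pchar (laurent K)].
Proof.
rewrite inE /= -(rmorph_nat (@poly_laurent K)) poly_laurent_eq0.
by rewrite -polyC_natr (pcharf0 char2K).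
Qed.

Lemma pd_letter_gt1 k : (1 < size (pd_letter a b k))%N.
Proof. by rewrite /pd_letter; case: odd. Qed.

Lemma vge_pd_err k : vge k%:Z (pd_err k).
Proof.
elim: k => [|k IHk] /=; first by move=> n n0; rewrite lcoef1 lt_eqF.
have h := vge_mul IHk (vge_poly_inv (pd_letter_gt1 k)).
by apply: vge_le (vge_mul h h); lia.
Qed.

Lemma vge_pd_sum k : vge 1 (pd_sum k).
Proof.
rewrite /pd_sum; elim/big_ind: _ => [||j _]; [by []|exact: vgeD|].
apply: (@vge_le _ 1 (j%:Z + 1)); first lia.
exact: vge_mul (@vge_pd_err j) (vge_poly_inv (pd_letter_gt1 j)).
Qed.

Lemma pd_core_gt1 k : all (fun p => 1 < size p)%N (pd_core a b k).
Proof. by elim: k => //= k IHk; rewrite all_cat /= IHk pd_letter_gt1. Qed.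

(** Induction along [w_(k+1) = w_k x_k w_k], by [pd_moebius_step]. Tails of
positive valuation keep every denominator nonzero. *)
Lemma cf_pd_core k t : vge 1 t ->
  cf_word (pd_core a b k) t = pd_sum k + pd_err k * t / (1 + pd_sum k * t).
Proof.
elim: k t => [|k IHk] t t1.
  by rewrite /pd_sum big_ord0 /= mul0r addr0 divr1 mul1r add0r.
set x := poly_laurent (pd_letter a b k).
have st1 : vge 1 (pd_sum k * t).
  by apply: vge_le (vge_mul (@vge_pd_sum k) t1).
have st0 := add1_vge1_neq0 st1.
have h1 := vge_cf_word (pd_core_gt1 k) t1.
have [xh0 u1] := vge_inv_add (pd_letter_gt1 k) h1.
have := h1; rewrite IHk // => g1.
have e1 : vge 1 (pd_err k * t / (1 + pd_sum k * t)).
  by rewrite -[_ / _](addKr (pd_sum k)); apply: vgeD g1; apply/vgeN/vge_pd_sum.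
have [xe0 _] := vge_inv_add (pd_letter_gt1 k) e1.
rewrite -/x (IHk t t1) in xh0 u1.
have x0 : x != 0 by rewrite poly_laurent_eq0 -size_poly_gt0 (ltn_trans _ (pd_letter_gt1 k)).
rewrite /= cf_word_cat -/x (IHk t t1) (IHk _ u1).
rewrite (pd_moebius_step pchar_laurent2 x0 st0 xe0 xh0).
by rewrite /pd_sum big_ord_recr.
Qed.

(** The word [w_(k+1)] has length [2^(k+1) - 1], so its last letter has index
[2^(k+1) - 2]. *)
Lemma expand_CFn_pd k :
  expand (CFn (period_doubling a b) (2 ^ k.+1).-2) = pd_sum k.+1.
Proof.
rewrite expand_CFn_word.
have h : (1 < 2 ^ k.+1)%N by rewrite expnS; have := expn_gt0 2 k; lia.
have -> : (2 ^ k.+1).-2.+1 = (2 ^ k.+1).-1 by lia.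
by rewrite pd_prefix cf_pd_core ?mulr0 ?mul0r ?addr0.
Qed.

Lemma pd_quartic_sum m : pd_quartic A B (pd_sum m.*2) =
  pd_err m.*2 ^+ 2 + B * (A + B) * pd_err m.*2.
Proof.
have A0 : A != 0 by rewrite poly_laurent_eq0 -size_poly_gt0 (ltn_trans _ a_gt1).
have B0 : B != 0 by rewrite poly_laurent_eq0 -size_poly_gt0 (ltn_trans _ b_gt1).
elim: m => [|m IHm].
  rewrite /pd_sum big_ord0 /pd_quartic /=; ring.
have -> : pd_sum m.+1.*2 =
    pd_sum m.*2 + pd_err m.*2 / A + (pd_err m.*2 / A) ^+ 2 / B.
  by rewrite /pd_sum doubleS !big_ord_recr /= /pd_letter /= odd_double.
rewrite (pd_quartic_step pchar_laurent2 A0 B0 IHm) doubleS /=.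
by rewrite /pd_letter /= odd_double.
Qed.

(** With [d] the distance from [S_(2m)] to the limit, additivity of the quartic
expresses its value at the limit as [pd_quartic_sum] plus a multiple of [d];
each of the two terms has arbitrarily large valuation. *)
Theorem pd_quartic_CF : pd_quartic A B (CF (period_doubling a b)) = 0.
Proof.
set y := CF _; apply: laurentP => i; rewrite lcoef0.
have [[N1 v1] [N2 v2]] := (vge_ex (A * B), vge_ex (A * B * (A + B))).
have [N3 v3] := vge_ex (B * (A + B)).
(* A common lower bound [N <= 0] for the valuations of the coefficients. *)
have [N [N0 [{}v1 [{}v2 {}v3]]]] : exists N : int, N <= 0 /\
    vge N (A * B) /\ vge N (A * B * (A + B)) /\ vge N (B * (A + B)).
  exists (- (absz N1 + absz N2 + absz N3)%N%:Z); split; first lia.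
  by split; [apply: vge_le v1|split; [apply: vge_le v2|apply: vge_le v3]]; lia.
(* Then a value of valuation at least [M + N] has no coefficient at [i]. *)
pose M := (absz i + absz N).+1%N.
have cvg : forall j, (1 < size (period_doubling a b j))%N.
  by move=> j; case: (pd_letter_or a b j) => ->.
have [n0 Hn0] := CF_cvg cvg M%:Z.
pose m := (n0 + M).+1; pose d := y - pd_sum m.*2.
have dM : vge M%:Z d.
  move=> j jM; rewrite lcoefD lcoefN.
  have -> : pd_sum m.*2 = pd_sum (m.*2.-1).+1 by congr pd_sum.
  rewrite -expand_CFn_pd Hn0 ?subrr //.
  by have := ltn_expl (m.*2.-1).+1 (leqnn 2); rewrite /m; lia.
have {Hn0} -> : y = pd_sum m.*2 + d by rewrite addrC subrK.
rewrite (pd_quarticD pchar_laurent2) pd_quartic_sum.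
have em := @vge_pd_err m.*2; set e := pd_err _ in em *.
have -> : e ^+ 2 + B * (A + B) * e = e * (e + B * (A + B)) by ring.
have d0 : vge 0 d by apply: vge_le dM.
suff: vge (M%:Z + N) (e * (e + B * (A + B)) +
    d * (d ^+ 3 + A * B * d + A * B * (A + B))) by apply; rewrite /M; lia.
apply: vgeD.
  apply: (@vge_le _ _ (m.*2%:Z + N)); first by rewrite /m; lia.
  apply: vge_mul => //; apply: vgeD => //; apply: vge_le em; lia.
apply: vge_mul => //; apply: vgeD => //; apply: vgeD.
  by apply: vge_le (vge_mul d0 (vge_mul d0 d0)); lia.
by apply: vge_le (vge_mul v1 d0); lia.
Qed.

Corollary root_pd_CF (y := CF (period_doubling a b)) :
  y ^+ 4 + poly_laurent (a * b) * y ^+ 2 + poly_laurent (a * b * (a + b)) * y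
    + poly_laurent (1 + b ^+ 2 + a * b) = 0.
Proof.
rewrite -[RHS]pd_quartic_CF /pd_quartic -/y.
by rewrite !(rmorphD, rmorphXn, rmorphM, rmorph1).
Qed.

End TwoLetters.
End Convergents.

(** * Irreducibility of a quartic without cubic term *)

Section DepressedQuartic.
Variable F : fieldType.
Implicit Types (p q : {poly F}) (c d e x s : F).

(** The gcd of [p] with any polynomial vanishing at [u] also vanishes at [u], so
it is not constant, hence associate to [p]. *)
Lemma minimal_polynomial_irreducible (E : fieldType) (iota : {rmorphism F -> E})
    (u : E) p :
  p \is monic -> irreducible_poly p -> root (map_poly iota p) u ->
  minimal_polynomial iota u p.
Proof.
move=> p_monic [_ p_irr] pu; split=> // q q0 qu.
have gu : root (map_poly iota (gcdp p q)) u by rewrite gcdp_map root_gcd pu.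
have g1 : size (gcdp p q) != 1%N.
  apply/eqP => /eqP/size_poly1P[c c0 gc]; move: gu.
  by rewrite gc map_polyC rootC fmorph_eq0 (negPf c0).
rewrite -(eqp_size (p_irr _ g1 (dvdp_gcdl p q))).
exact: dvdp_leq (dvdp_gcdr p q).
Qed.

Definition depressed_quartic c d e : {poly F} :=
  'X^4 + c%:P * 'X^2 + d%:P * 'X + e%:P.

Lemma size_depressed_quartic c d e : size (depressed_quartic c d e) = 5%N.
Proof.
rewrite /depressed_quartic -!addrA size_polyDl size_polyXn //.
apply: (leq_ltn_trans (size_polyD _ _)); rewrite gtn_max.
rewrite !mul_polyC (leq_ltn_trans (size_scale_leq _ _)) ?size_polyXn //.
apply: (leq_ltn_trans (size_polyD _ _)); rewrite gtn_max.
rewrite (leq_ltn_trans (size_scale_leq _ _)) ?size_polyX //=.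
exact: leq_ltn_trans (size_polyC_leq1 _) _.
Qed.

Lemma depressed_quartic_monic c d e : depressed_quartic c d e \is monic.
Proof.
rewrite monicE /lead_coef size_depressed_quartic /depressed_quartic.
by rewrite !coefD !coefCM !coefXn coefX coefC /= !mulr0 !addr0.
Qed.

Lemma horner_map_depressed_quartic (E : fieldType) (iota : {rmorphism F -> E})
    c d e (u : E) :
  (map_poly iota (depressed_quartic c d e)).[u] =
    u ^+ 4 + iota c * u ^+ 2 + iota d * u + iota e.
Proof.
rewrite /depressed_quartic !(rmorphD, rmorphXn, rmorphM) /= map_polyX.
by rewrite !map_polyC !hornerD !hornerCM !hornerXn hornerX hornerC.
Qed.

(** In a proper factorization one factor is linear or both are quadratic. In the
second case the monic factors are [Y^2 + s Y + t] and [Y^2 - s Y + t'], the cubic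
term being zero. *)
Lemma depressed_quartic_irreducible c d e :
    (forall x, x ^+ 4 + c * x ^+ 2 + d * x + e != 0) ->
    (forall s t t', t + t' - s ^+ 2 = c -> s * (t' - t) = d -> t * t' = e -> False) ->
  irreducible_poly (depressed_quartic c d e).
Proof.
move=> no_root no_quad; have szP := size_depressed_quartic c d e.
set P := depressed_quartic c d e in szP *.
have no_lin q : q %| P -> size q != 2%N.
  move=> qP; apply/eqP => /poly2_root[x qx].
  have /eqP := root_dvdp qP qx.
  rewrite !hornerD !hornerCM !hornerXn hornerX hornerC.
  exact/eqP/no_root.
split=> [|q q1 qP]; first by rewrite szP.
have P0 : P != 0 by rewrite -size_poly_gt0 szP.
have [h Ph] := dvdpP _ _ qP; have hP : h %| P by rewrite Ph dvdp_mulr.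
have /norP[h0 q0] : ~~ ((h == 0) || (q == 0)) by rewrite -mulf_eq0 -Ph.
rewrite -dvdp_size_eqp // szP.
have q2 := no_lin _ qP; have h2 := no_lin _ hP.
have := size_mul h0 q0; rewrite -Ph szP => szhq.
have hs : (0 < size h)%N by rewrite size_poly_gt0.
have [q5|q5] := eqVneq (size q) 5%N => //.
have qs : (0 < size q)%N by rewrite size_poly_gt0.
have [{}hs {}qs] : (size h = 3 /\ size q = 3)%N
  by move: szhq q1 q2 h2 q5 hs qs; move: (size h) (size q) => m n; lia.
have h_gt2 i : (2 < i)%N -> h`_i = 0 by move=> i2; rewrite nth_default ?hs.
have q_gt2 i : (2 < i)%N -> q`_i = 0 by move=> i2; rewrite nth_default ?qs.
have hc i : P`_i = (h * q)`_i by rewrite Ph.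
have := hc 0%N; have := hc 1%N; have := hc 2%N; have := hc 3%N; have := hc 4%N.
rewrite !coefM !big_ord_recl !big_ord0 /= /bump /= !add1n ?add0n !subSS ?subn0.
rewrite (h_gt2 3%N) // (h_gt2 4%N) // (q_gt2 3%N) // (q_gt2 4%N) //.
rewrite /P /depressed_quartic !coefD !coefCM !coefXn !coefX !coefC /=.
rewrite !(mulr0, mul0r, addr0, add0r, mulr1) => E4 E3 E2 E1 E0.
have q20 : q`_2 != 0 by apply: contra_eq_neq E4 => ->; rewrite mulr0 oner_eq0.
have h2E : h`_2 = (q`_2)^-1 by rewrite -[LHS](mulfK q20) -E4 mul1r.
have h1E : h`_1 = - q`_1 / q`_2 ^+ 2.
  apply: (mulIf q20); apply/eqP; rewrite -subr_eq0; apply/eqP.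
  by rewrite [RHS]E3 h2E; field.
case: (no_quad (q`_1 / q`_2) (q`_0 / q`_2) (h`_0 * q`_2)).
- by rewrite E2 h2E h1E; field.
- by rewrite E1 h1E; field.
- by rewrite E0; field.
Qed.

End DepressedQuartic.

(** * Irreducibility of the quartic over the rational fractions *)

Lemma fraction_coprime (K : fieldType) (x : {fraction {poly K}}) :
  exists p q : {poly K}, [/\ q != 0, coprimep p q & x = p%:F / q%:F].
Proof.
have [p [q [q0 ->]]] := fracP x; have g0 : gcdp p q != 0 by rewrite gcdp_eq0 negb_and q0 orbT.
exists (p %/ gcdp p q), (q %/ gcdp p q); split.
- by rewrite dvdp_div_eq0 ?dvdp_gcdr.
- by rewrite coprimep_div_gcd // q0 orbT.
have pE := divpK (dvdp_gcdl p q); have qE := divpK (dvdp_gcdr p q).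
rewrite -[in LHS]pE -[in X in _ / X]qE !tofracM -mulf_div divff ?mulr1 //.
by rewrite tofrac_eq0.
Qed.

Local Notation F2z := {poly 'F_2}.

Definition alpha : F2z := 'X^5 + 'X^4 + 'X^3.
Definition beta : F2z := 'X^8 + 'X^6 + 'X^5 + 'X^3.
Definition gamma : F2z := 'X^5 + 'X^3 + 'X^2.

Lemma quartic_clear_denom (F : fieldType) (u v c d e : F) : v != 0 ->
  (u / v) ^+ 4 + c * (u / v) ^+ 2 + d * (u / v) + e = 0 ->
  u ^+ 4 + c * u ^+ 2 * v ^+ 2 + d * u * v ^+ 3 + e * v ^+ 4 = 0.
Proof. by move=> v0 E; rewrite -[RHS](mulr0 (v ^+ 4)) -E; field. Qed.

Lemma cubic_clear_denom (F : fieldType) (u v c d : F) : v != 0 ->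
  (u / v) ^+ 3 + c * (u / v) = d ->
  u ^+ 3 + c * u * v ^+ 2 = d * v ^+ 3.
Proof. by move=> v0 <-; field. Qed.

Lemma tofrac_quartic_root (R : idomainType) (u v c d e : R) : v != 0 ->
    (u%:F / v%:F) ^+ 4 + c%:F * (u%:F / v%:F) ^+ 2 + d%:F * (u%:F / v%:F) + e%:F = 0 ->
  u ^+ 4 + c * u ^+ 2 * v ^+ 2 + d * u * v ^+ 3 + e * v ^+ 4 = 0.
Proof.
rewrite -tofrac_eq0 => v0 E.
apply/eqP; rewrite -tofrac_eq0 !(tofracD, tofracXn, tofracM); apply/eqP.
exact: quartic_clear_denom v0 E.
Qed.

Lemma tofrac_cubic_eq (R : idomainType) (u v c d : R) : v != 0 ->
    (u%:F / v%:F) ^+ 3 + c%:F * (u%:F / v%:F) = d%:F ->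
  u ^+ 3 + c * u * v ^+ 2 = d * v ^+ 3.
Proof.
rewrite -tofrac_eq0 => v0 E.
apply/eqP; rewrite -tofrac_eq !(tofracD, tofracXn, tofracM); apply/eqP.
exact: cubic_clear_denom v0 E.
Qed.

(** Newton polygon at [z = 0], for a root in lowest terms [u / v]: [z] divides
[u^4], hence [u]; then [z^3] divides all terms but [gamma v^4], and [gamma] is
[z^2] times a unit at 0, so [z] divides [v] as well. *)
Lemma quartic_no_root (x : {fraction F2z}) :
  x ^+ 4 + alpha%:F * x ^+ 2 + beta%:F * x + gamma%:F != 0.
Proof.
have [u [v [v0 uv ->]]] := fraction_coprime x.
apply/eqP => /(tofrac_quartic_root v0) E.
(* A multiple of ['X] has no constant term. *)
have root0 (p g : F2z) n : p ^+ n.+1 = 'X * g -> root p 0.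
  move/(congr1 (fun q : F2z => q.[0])); rewrite horner_exp hornerM hornerX mul0r.
  by move/eqP; rewrite expf_eq0 => /andP[].
have u0 : root u 0.
  apply: (root0 _ (- (('X^4 + 'X^3 + 'X^2) * u ^+ 2 * v ^+ 2
    + ('X^7 + 'X^5 + 'X^4 + 'X^2) * u * v ^+ 3 + ('X^4 + 'X^2 + 'X) * v ^+ 4)) 3).
  by rewrite -[LHS]subr0 -E /alpha /beta /gamma; ring.
have [w uE] : exists w, u = w * 'X.
  by have [w] := factor_theorem _ _ u0; rewrite subr0; exists w.
pose g := 'X * w ^+ 4 + ('X^4 + 'X^3 + 'X^2) * w ^+ 2 * v ^+ 2
  + ('X^6 + 'X^4 + 'X^3 + 'X) * w * v ^+ 3 + ('X^2 + 1) * v ^+ 4.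
have {}E : 'X^2 * ('X * g + v ^+ 4) = 0.
  by rewrite -E uE /g /alpha /beta /gamma; ring.
have v0' : root v 0.
  apply: (root0 _ (- g) 3); apply/eqP; rewrite mulrN -subr_eq0 opprK addrC.
  by move/eqP: E; rewrite mulf_eq0 expf_eq0 polyX_eq0.
by move: v0'; rewrite rootE (negPf (coprimep_root uv u0)).
Qed.

Lemma size_alpha : size alpha = 6%N.
Proof. by rewrite /alpha; repeat rewrite size_polyDl; rewrite ?size_polyXn. Qed.

Lemma size_beta : size beta = 9%N.
Proof. by rewrite /beta; repeat rewrite size_polyDl; rewrite ?size_polyXn. Qed.

(** For [s = u / v], compare the degrees of the three terms of
[u^3 + alpha u v^2 = beta v^3]: the largest is attained once, by [beta v^3] if
[deg u <= deg v + 2] and by [u^3] otherwise. *)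
Lemma resolvent_no_root (s : {fraction F2z}) :
  s ^+ 3 + alpha%:F * s != beta%:F.
Proof.
have [u [v [v0 ->]]] := fracP s.
apply/eqP => /(tofrac_cubic_eq v0) E.
have a0 : alpha != 0 by rewrite -size_poly_gt0 size_alpha.
have b0 : beta != 0 by rewrite -size_poly_gt0 size_beta.
have u0 : u != 0.
  apply: contraNneq v0 => u0; move/eqP: E.
  rewrite u0 expr0n mulr0 mul0r addr0 eq_sym mulf_eq0 (negPf b0) /=.
  by rewrite expf_eq0.
have szM (p q : F2z) n : p != 0 -> q != 0 -> (size (p * q ^+ n)).-1 =
   ((size p).-1 + n * (size q).-1)%N.
  move=> p0 q0; have qn0 : q ^+ n != 0 by rewrite expf_neq0.
  rewrite size_mul //; have := size_exp q n; move: p0 qn0.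
  rewrite -!size_poly_gt0.
  by move: (size p) (size (q ^+ n)) (size q) => i j k; lia.
have szb : size (beta * v ^+ 3) = (9 + 3 * (size v).-1)%N.
  rewrite -[LHS]prednK ?size_poly_gt0 ?mulf_neq0 ?expf_neq0 //.
  by rewrite szM // size_beta.
have sza : size (alpha * u * v ^+ 2) = (6 + (size u).-1 + 2 * (size v).-1)%N.
  rewrite -[LHS]prednK ?size_poly_gt0 ?mulf_neq0 ?expf_neq0 // szM ?mulf_neq0 //.
  by have := szM alpha u 1%N a0 u0; rewrite expr1 size_alpha mul1n => ->.
have szu : size (u ^+ 3) = (1 + 3 * (size u).-1)%N.
  by rewrite -[LHS]prednK ?size_poly_gt0 ?expf_neq0 // size_exp mulnC.
have [uv|uv] := leqP (size u).-1 ((size v).-1 + 2).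
  have : (size (beta * v ^+ 3)%R <= maxn (size (u ^+ 3)%R) (size (alpha * u * v ^+ 2)%R))%N.
    by rewrite -E size_polyD.
  by rewrite szb szu sza; move: uv; move: (size u).-1 (size v).-1 => i j; lia.
have : size (u ^+ 3 + alpha * u * v ^+ 2) = size (u ^+ 3).
  by rewrite size_polyDl // szu sza; move: uv; move: (size u).-1 (size v).-1 => i j; lia.
by rewrite E szb szu; move: uv; move: (size u).-1 (size v).-1 => i j; lia.
Qed.

Lemma quartic_irreducible :
  irreducible_poly (depressed_quartic alpha%:F beta%:F gamma%:F).
Proof.
have char2F : 2%N \in [pchar {fraction {poly 'F_2}}].
  rewrite inE /= -(rmorph_nat (@FracField.tofrac {poly 'F_2})) tofrac_eq0.
  by rewrite -polyC_natr polyC_eq0.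
apply: depressed_quartic_irreducible quartic_no_root _ => s t t' ac bc _.
case/eqP: (resolvent_no_root s); rewrite -ac -bc !(oppr_pchar2 char2F).
transitivity (s * (t' + t) + (s ^+ 3 + s ^+ 3)); first ring.
by rewrite addrr_pchar2 ?addr0.
Qed.


Theorem theorem4p5 :
  let a : {poly 'F_2} := 'X^3 in
  let b : {poly 'F_2} := 'X^2 + 'X + 1 in
  let y : laurent 'F_2 := CF (period_doubling a b) in
  let P : {poly {fraction {poly 'F_2}}} :=
    'X^4 + (('X^5 + 'X^4 + 'X^3 : {poly 'F_2})%:F)%:P * 'X^2
         + (('X^8 + 'X^6 + 'X^5 + 'X^3 : {poly 'F_2})%:F)%:P * 'X
         + (('X^5 + 'X^3 + 'X^2 : {poly 'F_2})%:F)%:P in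
  algebraicOver (@expand 'F_2) y /\ minimal_polynomial (@expand 'F_2) y P.
Proof.
move=> a b y P.
have char2 : 2%N \in [pchar 'F_2] by rewrite pchar_Fp.
have two0 : 2%:R = 0 :> {poly 'F_2} by rewrite -polyC_natr (pcharf0 char2).
have a1 : (1 < size a)%N by rewrite size_polyXn.
have b1 : (1 < size b)%N.
  by rewrite /b; repeat rewrite size_polyDl; rewrite ?(size_polyXn, size_polyX, size_poly1).
(* In [Z[z]] the two sides differ by the given multiple of 2. *)
have betaE : beta = a * b * (a + b).
  apply/eqP; rewrite -subr_eq0; apply/eqP.
  transitivity (- 2%:R * ('X^7 + 'X^6 + 'X^5 + 'X^4) : {poly 'F_2}); last first.
    by rewrite two0 oppr0 mul0r.
  rewrite /beta /a /b; ring.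
have gammaE : gamma = 1 + b ^+ 2 + a * b.
  apply/eqP; rewrite -subr_eq0; apply/eqP.
  transitivity (- 2%:R * (1 + 'X + 'X^2 + 'X^3 + 'X^4) : {poly 'F_2}); last first.
    by rewrite two0 oppr0 mul0r.
  rewrite /gamma /a /b; ring.
have alphaE : alpha = a * b by rewrite /alpha /a /b; ring.
have Py : root (map_poly (@expand 'F_2) P) y.
  rewrite [P](_ : _ = depressed_quartic alpha%:F beta%:F gamma%:F) //.
  rewrite rootE horner_map_depressed_quartic /=.
  by rewrite !expand_tofrac gammaE alphaE betaE root_pd_CF.
have Pmonic : P \is monic by apply: depressed_quartic_monic.
split; first by exists P; rewrite ?monic_neq0.
exact: (minimal_polynomial_irreducible Pmonic quartic_irreducible Py).
Qed.
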